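(* Let $k$ be a field of characteristic $0$ and let $\Theta$ be the variety of all commutative (not necessarily associative) linear algebras over $k$. Let $\varphi\neq \mathrm{id}_k$ be an automorphism of the field $k$, and fix $\lambda\in k$ with $\varphi(\lambda)\neq\lambda$. Let $F=F(x_1,x_2)$ be the free algebra of $\Theta$ on two free generators, let $T$ be the ideal of $F$ generated by $t=\lambda x_1(x_1x_2)+x_2(x_1^2)$ together with $F^4$, and let $H=F/T$. Let $H^{\ast}_W$ be the algebra with the same underlying set, zero, addition and multiplication as $H$, but with multiplication by scalars given by $\mu\ast h=\varphi(\mu)h$ for $\mu\in k$, $h\in H$. Then $H$ and $H^{\ast}_W$ are not geometrically equivalent.
   Context: A linear algebra over $k$ is a $k$-vector space with a $k$-bilinear multiplication (not assumed associative, commutative or unital); homomorphisms are $k$-linear multiplicative maps, and ''ideal'' means two-sided ideal. $F^j$ denotes the ideal of $F$ spanned by all monomials in the free generators of total degree at least $j$. Let $X_0=\{x_1,x_2,\ldots\}$ be a countable set; for finite $X\subset X_0$ let $F(X)$ be the free algebra of $\Theta$ on $X$. For $H\in\Theta$ and $S\subseteq F(X)$ put $S''_H=\bigcap\{\ker\mu\mid\mu\in\mathrm{Hom}(F(X),H),\ S\subseteq\ker\mu\}$, where $\ker\mu$ is the ideal $\mu^{-1}(0)$. Algebras $H_1,H_2\in\Theta$ are geometrically equivalent if $S''_{H_1}=S''_{H_2}$ for every finite $X\subset X_0$ and every $S\subseteq F(X)$. *)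

(* Defs.v *)
From HB Require Import structures.
From mathcomp Require Import all_boot all_order all_algebra finmap.
From mathcomp Require Import boolp classical_sets.
From mathcomp Require Import monalg.

Set Implicit Arguments.
Unset Strict Implicit.
Unset Printing Implicit Defensive.

Import GRing.Theory.

Local Open Scope classical_set_scope.
Local Open Scope ring_scope.

Reserved Notation "x ** y" (at level 40, left associativity).

(* The product is neither assumed associative nor unital. *)
HB.mixin Record Lmodule_isLinAlg (k : fieldType) V of GRing.Lmodule k V := {
  nmul : V -> V -> V;
  nmulDl_subproof : forall x y z, nmul (x + y) z = nmul x z + nmul y z;
  nmulDr_subproof : forall x y z, nmul x (y + z) = nmul x y + nmul x z;
  nmulZl_subproof : forall (c : k) x y, nmul (c *: x) y = c *: nmul x y;
  nmulZr_subproof : forall (c : k) x y, nmul x (c *: y) = c *: nmul x y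
}.

#[short(type="linAlgType")]
HB.structure Definition LinAlg (k : fieldType) :=
  {V of GRing.Lmodule k V & Lmodule_isLinAlg k V}.

HB.mixin Record LinAlg_isCom (k : fieldType) V of LinAlg k V := {
  nmulC_subproof : commutative (@nmul k V)
}.

#[short(type="comLinAlgType")]
HB.structure Definition ComLinAlg (k : fieldType) :=
  {V of LinAlg k V & LinAlg_isCom k V}.

Notation "x ** y" := (nmul x y) : ring_scope.

Section LinAlgTheory.
Context (k : fieldType) (A : linAlgType k).
Implicit Types x y z : A.

Lemma nmulDl x y z : (x + y) ** z = x ** z + y ** z.
Proof. exact: nmulDl_subproof. Qed.

Lemma nmulDr x y z : x ** (y + z) = x ** y + x ** z.
Proof. exact: nmulDr_subproof. Qed.

Lemma nmulZl (c : k) x y : (c *: x) ** y = c *: (x ** y).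
Proof. exact: nmulZl_subproof. Qed.

Lemma nmulZr (c : k) x y : x ** (c *: y) = c *: (x ** y).
Proof. exact: nmulZr_subproof. Qed.

Lemma nmul0l x : 0 ** x = 0.
Proof. by rewrite -[X in X ** _](scale0r 0) nmulZl scale0r. Qed.

Lemma nmul0r x : x ** 0 = 0.
Proof. by rewrite -[X in _ ** X](scale0r 0) nmulZr scale0r. Qed.

End LinAlgTheory.

Lemma nmulC (k : fieldType) (A : comLinAlgType k) (x y : A) : x ** y = y ** x.
Proof. exact: nmulC_subproof. Qed.

Section Homs.
Context (k : fieldType).

Record alg_hom (A B : linAlgType k) := AlgHom {
  hom_linear :> {linear A -> B};
  homM : {morph hom_linear : x y / x ** y}
}.

Definition alg_ker (A B : linAlgType k) (mu : alg_hom A B) : set A :=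
  [set x | mu x = 0].

Definition is_subspace (V : lmodType k) (U : set V) : Prop :=
  [/\ U 0, forall x y, U x -> U y -> U (x + y) &
      forall (c : k) x, U x -> U (c *: x)].

Definition is_ideal (A : linAlgType k) (I : set A) : Prop :=
  is_subspace I /\ forall a x, I x -> I (a ** x) /\ I (x ** a).

Record ideal (A : linAlgType k) := Ideal {
  ideal_set :> set A;
  idealP : is_ideal ideal_set
}.

Lemma smallest_ideal (A : linAlgType k) (S : set A) :
  is_ideal (smallest (@is_ideal A) S).
Proof.
split; first split.
- by move=> I [[[]]].
- by move=> x y hx hy I hI; case: (hI) => -[[_ + _] _] _; apply;
    [apply: hx|apply: hy].
- by move=> c x hx I hI; case: (hI) => -[[_ _ +] _] _; apply; apply: hx.
- by move=> a x hx; split=> I hI; case: (hI) => -[_ /(_ a x (hx I hI)) []].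
Qed.

Definition ideal_gen (A : linAlgType k) (S : set A) : ideal A :=
  Ideal (smallest_ideal S).

End Homs.

Section Quotient.
Context (k : fieldType).

Definition ideal_pred (A : linAlgType k) (I : ideal A) : pred A :=
  fun x => `[< ideal_set I x >].

Lemma ideal_pred_closed (A : linAlgType k) (I : ideal A) :
  zmod_closed (ideal_pred I).
Proof.
have [[I0 ID IZ] _] := idealP I.
split=> [|x y /asboolP hx /asboolP hy]; apply/asboolP => //.
by apply: ID => //; rewrite -scaleN1r; apply: IZ.
Qed.

HB.instance Definition _ (A : linAlgType k) (I : ideal A) :=
  GRing.isZmodClosed.Build A (ideal_pred I) (ideal_pred_closed I).

Definition ideal_closed (A : linAlgType k) (I : ideal A) : zmodClosed A :=
  GRing.ZmodClosed.clone A (ideal_pred I) _.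

Definition quot_alg (A : linAlgType k) (I : ideal A) : Type :=
  Quotient.quot (ideal_closed I).

HB.instance Definition _ (A : linAlgType k) (I : ideal A) :=
  GRing.Zmodule.on (quot_alg I).

Section Operations.
Context (A : linAlgType k) (I : ideal A).
Local Notation Q := (quot_alg I).

Definition quot_pi (x : A) : Q := \pi_(Quotient.quot (ideal_closed I))%qT x.

Definition quot_repr (a : Q) : A := repr (a : Quotient.quot (ideal_closed I)).

Lemma quot_reprK a : quot_pi (quot_repr a) = a.
Proof. exact: reprK. Qed.

Lemma quot_pi_eq x y : quot_pi x = quot_pi y <-> ideal_set I (x - y).
Proof.
rewrite /quot_pi; split.
  by move/eqP; rewrite -Quotient.idealrBE => /asboolP.
by move=> h; apply/eqP; rewrite -Quotient.idealrBE; apply/asboolP.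
Qed.

Lemma quot_piD x y : quot_pi (x + y) = quot_pi x + quot_pi y.
Proof. exact: (raddfD (\pi_(Quotient.quot (ideal_closed I))%qT)). Qed.

Lemma quot_repr_pi x : ideal_set I (quot_repr (quot_pi x) - x).
Proof. by apply/quot_pi_eq; rewrite quot_reprK. Qed.

Definition quot_scale (c : k) (a : Q) : Q := quot_pi (c *: quot_repr a).

Lemma quot_pi_scale c x : quot_scale c (quot_pi x) = quot_pi (c *: x).
Proof.
apply/quot_pi_eq; rewrite -scalerBr.
by have [[_ _ IZ] _] := idealP I; apply/IZ/quot_repr_pi.
Qed.

Fact quot_scalerA a b v :
  quot_scale a (quot_scale b v) = quot_scale (a * b) v.
Proof. by rewrite -[v]quot_reprK !quot_pi_scale scalerA. Qed.
Fact quot_scale1r : left_id 1 quot_scale.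
Proof. by move=> v; rewrite -[v]quot_reprK quot_pi_scale scale1r. Qed.
Fact quot_scalerDr : right_distributive quot_scale +%R.
Proof.
move=> a u v; rewrite -[u]quot_reprK -[v]quot_reprK -quot_piD !quot_pi_scale.
by rewrite scalerDr quot_piD.
Qed.
Fact quot_scalerDl v : {morph quot_scale^~ v : a b / a + b}.
Proof.
by move=> a b; rewrite -[v]quot_reprK !quot_pi_scale scalerDl quot_piD.
Qed.

HB.instance Definition _ := GRing.Zmodule_isLmodule.Build k Q
  quot_scalerA quot_scale1r quot_scalerDr quot_scalerDl.

Lemma quot_piZ c x : quot_pi (c *: x) = c *: quot_pi x.
Proof. by rewrite -quot_pi_scale. Qed.

Definition quot_mul (a b : Q) : Q := quot_pi (quot_repr a ** quot_repr b).

Lemma quot_pi_mul x y : quot_mul (quot_pi x) (quot_pi y) = quot_pi (x ** y).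
Proof.
have [[_ ID IZ] IM] := idealP I.
apply/quot_pi_eq; set x' := quot_repr _; set y' := quot_repr _.
have -> : x' ** y' - x ** y = (x' - x) ** y' + x ** (y' - y).
  rewrite nmulDl nmulDr -!scaleN1r nmulZl nmulZr !scaleN1r.
  by rewrite addrA subrK.
by apply: ID; [case: (IM y' (x' - x) (quot_repr_pi x))
              |case: (IM x (y' - y) (quot_repr_pi y))].
Qed.

Fact quot_mulDl x y z : quot_mul (x + y) z = quot_mul x z + quot_mul y z.
Proof.
rewrite -[x]quot_reprK -[y]quot_reprK -[z]quot_reprK -quot_piD !quot_pi_mul.
by rewrite nmulDl quot_piD.
Qed.
Fact quot_mulDr x y z : quot_mul x (y + z) = quot_mul x y + quot_mul x z.
Proof.
rewrite -[x]quot_reprK -[y]quot_reprK -[z]quot_reprK -quot_piD !quot_pi_mul.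
by rewrite nmulDr quot_piD.
Qed.
Fact quot_mulZl (c : k) x y : quot_mul (c *: x) y = c *: quot_mul x y.
Proof.
rewrite -[x]quot_reprK -[y]quot_reprK -quot_piZ !quot_pi_mul.
by rewrite nmulZl quot_piZ.
Qed.
Fact quot_mulZr (c : k) x y : quot_mul x (c *: y) = c *: quot_mul x y.
Proof.
rewrite -[x]quot_reprK -[y]quot_reprK -quot_piZ !quot_pi_mul.
by rewrite nmulZr quot_piZ.
Qed.

HB.instance Definition _ := Lmodule_isLinAlg.Build k Q
  quot_mulDl quot_mulDr quot_mulZl quot_mulZr.

Lemma quot_piM x y : quot_pi (x ** y) = quot_pi x ** quot_pi y.
Proof. by rewrite -quot_pi_mul. Qed.

End Operations.

Fact quot_mulC (A : comLinAlgType k) (I : ideal A) :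
  commutative (@nmul k (quot_alg I)).
Proof.
move=> x y; rewrite -[x]quot_reprK -[y]quot_reprK -!quot_piM.
by rewrite nmulC.
Qed.

HB.instance Definition _ (A : comLinAlgType k) (I : ideal A) :=
  LinAlg_isCom.Build k (quot_alg I) (@quot_mulC A I).

End Quotient.

(* [twist phi A] is the algebra $A^*_W$: same additive group and product, and
   [c] acts as [phi c] does on [A]. *)
Definition twist (k : fieldType) (phi : {rmorphism k -> k})
  (A : lmodType k) : Type := A.

Section Twist.
Context (k : fieldType) (phi : {rmorphism k -> k}).

HB.instance Definition _ (A : lmodType k) := GRing.Zmodule.on (twist phi A).

Section Scale.
Context (A : lmodType k).

Definition twist_scale (c : k) (x : twist phi A) : twist phi A :=
  phi c *: (x : A).

Fact twist_scalerA a b v :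
  twist_scale a (twist_scale b v) = twist_scale (a * b) v.
Proof. by rewrite /twist_scale scalerA rmorphM. Qed.
Fact twist_scale1r : left_id 1 twist_scale.
Proof. by move=> v; rewrite /twist_scale rmorph1 scale1r. Qed.
Fact twist_scalerDr : right_distributive twist_scale +%R.
Proof. by move=> a u v; apply: (@scalerDr _ A). Qed.
Fact twist_scalerDl v : {morph twist_scale^~ v : a b / a + b}.
Proof. by move=> a b; rewrite /twist_scale rmorphD; apply: (@scalerDl _ A). Qed.

HB.instance Definition _ := GRing.Zmodule_isLmodule.Build k (twist phi A)
  twist_scalerA twist_scale1r twist_scalerDr twist_scalerDl.

End Scale.

HB.instance Definition _ (A : linAlgType k) :=
  Lmodule_isLinAlg.Build k (twist phi A)
    (@nmulDl k A) (@nmulDr k A)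
    (fun c => @nmulZl k A (phi c)) (fun c => @nmulZr k A (phi c)).

HB.instance Definition _ (A : comLinAlgType k) :=
  LinAlg_isCom.Build k (twist phi A) (@nmulC k A).

End Twist.

(* Nonassociative words, i.e. binary trees with leaves in [V]. *)
Inductive word (V : Type) : Type :=
  | Leaf of V
  | Node of word V & word V.

Section Words.
Context (V : choiceType).

Fixpoint word_encode (w : word V) : GenTree.tree V :=
  match w with
  | Leaf v => GenTree.Leaf v
  | Node a b => GenTree.Node 0 [:: word_encode a; word_encode b]
  end.

Fixpoint word_decode (t : GenTree.tree V) : option (word V) :=
  match t with
  | GenTree.Leaf v => Some (Leaf v)
  | GenTree.Node _ [:: a; b] =>
      if (word_decode a, word_decode b) is (Some a', Some b')
      then Some (Node a' b') else None
  | _ => None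
  end.

Lemma word_encodeK : pcancel word_encode word_decode.
Proof. by elim=> [//|a IHa b IHb] /=; rewrite IHa IHb. Qed.

HB.instance Definition _ := Choice.copy (word V) (pcan_type word_encodeK).

Fixpoint word_size (w : word V) : nat :=
  match w with
  | Leaf _ => 1
  | Node a b => word_size a + word_size b
  end.

(* Equality of words up to commutativity of the product. *)
Fixpoint weq (w1 w2 : word V) {struct w1} : bool :=
  match w1, w2 with
  | Leaf v1, Leaf v2 => v1 == v2
  | Node a b, Node c d => (weq a c && weq b d) || (weq a d && weq b c)
  | _, _ => false
  end.

Lemma weq_refl : reflexive weq.
Proof. by elim=> [v|a IHa b IHb] /=; rewrite ?eqxx // IHa IHb. Qed.

Lemma weq_sym : symmetric weq.
Proof.
elim=> [v|a IHa b IHb] [w|c d] //=; rewrite ?(eq_sym v) // !IHa !IHb.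
by rewrite [weq d a && _]andbC.
Qed.

Lemma weq_trans : transitive weq.
Proof.
move=> w2 w1; elim: w2 w1 => [v|a IHa b IHb] [u|c d] [w|e f] //=.
  by move=> /eqP-> /eqP->.
by case/orP=> /andP[h1 h2] /orP[] /andP[h3 h4]; apply/orP;
  [left|right|right|left]; apply/andP; split;
  first [exact: IHa h1 h3 | exact: IHb h2 h4 | exact: IHa h2 h3
        |exact: IHb h1 h4].
Qed.

Canonical weq_equiv := EquivRel weq weq_refl weq_sym weq_trans.

(* Commutative nonassociative monomials, the basis of the free algebra. *)
Definition monom : Type := {eq_quot weq}%qT.

HB.instance Definition _ := Choice.on monom.
HB.instance Definition _ := EqQuotient.on monom.

Definition mvar (v : V) : monom := (\pi_monom (Leaf v))%qT.

Definition monom_mul (a b : monom) : monom :=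
  (\pi_monom (Node (repr a) (repr b)))%qT.

Definition mdegree (a : monom) : nat := word_size (repr a).

Lemma monom_piP (w1 w2 : word V) :
  reflect ((\pi_monom w1)%qT = (\pi_monom w2)%qT) (weq w1 w2).
Proof. exact: (@eqmodP _ weq_equiv). Qed.

Lemma weq_repr (w : word V) : weq (repr (\pi_monom w)%qT) w.
Proof. by apply/monom_piP; rewrite reprK. Qed.

Lemma monom_mulC : commutative monom_mul.
Proof. by move=> a b; apply/monom_piP; rewrite /= !weq_refl orbT. Qed.

Lemma monom_mul_pi w1 w2 :
  monom_mul (\pi_monom w1)%qT (\pi_monom w2)%qT = (\pi_monom (Node w1 w2))%qT.
Proof. by apply/monom_piP; rewrite /= !weq_repr. Qed.

Lemma weq_size w1 w2 : weq w1 w2 -> word_size w1 = word_size w2.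
Proof.
elim: w1 w2 => [v|a IHa b IHb] [w|c d] //=.
by case/orP=> /andP[/IHa-> /IHb->] //; rewrite addnC.
Qed.

Lemma mdegree_var v : mdegree (mvar v) = 1%N.
Proof. by rewrite /mdegree (weq_size (weq_repr _)). Qed.

Lemma mdegree_mul a b : mdegree (monom_mul a b) = (mdegree a + mdegree b)%N.
Proof. by rewrite /mdegree (weq_size (weq_repr _)). Qed.

Lemma monom_ind (P : monom -> Prop) :
  (forall v, P (mvar v)) -> (forall a b, P a -> P b -> P (monom_mul a b)) ->
  forall a, P a.
Proof.
move=> hv hm a; rewrite -[a]reprK; elim: (repr a) => [v|b IHb c IHc].
  exact: hv.
by rewrite -monom_mul_pi; apply: hm.
Qed.

End Words.

(* The free commutative algebra on [V]: finitely supported [k]-valued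
   functions on the monomials (its universal property is [free_universal]). *)
Definition free_alg (k : fieldType) (V : choiceType) : Type :=
  {malg k[monom V]}.

HB.instance Definition _ (k : fieldType) (V : choiceType) :=
  GRing.Zmodule.on (free_alg k V).

(* Locking keeps unification from unfolding the [malg] implementation. *)
HB.lock Definition free_scale (k : fieldType) (V : choiceType) (c : k)
  (f : free_alg k V) : free_alg k V := c *: (f : {malg k[monom V]}).

Section FreeModule.
Context (k : fieldType) (V : choiceType).
Local Notation F := (free_alg k V).

Fact free_scalerA (a b : k) (f : F) :
  free_scale a (free_scale b f) = free_scale (a * b) f.
Proof. by rewrite free_scale.unlock; exact: scalerA. Qed.
Fact free_scale1r : left_id 1 (@free_scale k V).
Proof. by rewrite free_scale.unlock; exact: scale1r. Qed.
Fact free_scalerDr : right_distributive (@free_scale k V) +%R.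
Proof. by rewrite free_scale.unlock; exact: scalerDr. Qed.
Fact free_scalerDl (f : F) : {morph (@free_scale k V)^~ f : a b / a + b}.
Proof. by move=> a b; rewrite free_scale.unlock; exact: scalerDl. Qed.

HB.instance Definition _ := GRing.Zmodule_isLmodule.Build k F
  free_scalerA free_scale1r free_scalerDr free_scalerDl.

End FreeModule.

HB.lock Definition free_mono (k : fieldType) (V : choiceType) (m : monom V) :
  free_alg k V := << m >>.

HB.lock Definition free_coef (k : fieldType) (V : choiceType) (m : monom V)
  (f : free_alg k V) : k := f@_m.

(* Linear extension of a map defined on monomials. *)
HB.lock Definition lext (k : fieldType) (V : choiceType) (W : lmodType k)
    (h : monom V -> W) (f : free_alg k V) : W :=
  \sum_(m <- msupp f) free_coef m f *: h m.

Section FreeAlgebra.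
Context (k : fieldType).
Local Notation free_alg := (free_alg k).

Section Theory.
Context (V : choiceType).

Definition free_gen (v : V) : free_alg V := free_mono k (mvar v).

Lemma free_coef_is_linear m : linear_for *%R (@free_coef k V m).
Proof.
move=> c f g; rewrite unlock /GRing.scale /= free_scale.unlock.
transitivity ((c *: (f : {malg k[monom V]}))@_m + g@_m).
  exact: (@mcoeffD (monom V) k m).
by congr (_ + _); exact: (@mcoeffZ (monom V) k c f m).
Qed.

HB.instance Definition _ m :=
  GRing.isLinear.Build k (free_alg V) k *%R (@free_coef k V m)
    (free_coef_is_linear m).

Lemma free_coef_mono (m m' : monom V) :
  free_coef m (free_mono k m') = (m' == m)%:R.
Proof. by rewrite !unlock; exact: (@mcoeffU (monom V) k m' 1 m). Qed.

Lemma free_coefP (f g : free_alg V) :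
  (forall m, free_coef m f = free_coef m g) -> f = g.
Proof. by rewrite unlock => e; apply/(@malgP (monom V) k). Qed.

Lemma free_coef_supp (f : free_alg V) m :
  (free_coef m f != 0) = (m \in msupp f).
Proof. by rewrite unlock; exact: (@mcoeff_neq0 (monom V) k f m). Qed.

Section Lext.
Context (W : lmodType k) (h : monom V -> W).

Lemma lextw (f : free_alg V) (D : {fset monom V}) : (msupp f `<=` D)%fset ->
  lext h f = \sum_(m <- D) free_coef m f *: h m.
Proof.
move=> sub; rewrite lext.unlock (big_fset_incl _ sub) // => m _.
by rewrite -free_coef_supp negbK => /eqP->; rewrite scale0r.
Qed.

Lemma lext_is_linear : linear (lext h).
Proof.
move=> c f g; pose D := (msupp f `|` msupp g `|` msupp (c *: f + g))%fset.
have Df : (msupp f `<=` D)%fset by rewrite /D -fsetUA fsubsetUl.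
have Dg : (msupp g `<=` D)%fset by rewrite /D fsetUAC fsubsetUr.
have Dfg : (msupp (c *: f + g) `<=` D)%fset by rewrite /D fsubsetUr.
rewrite (lextw Df) (lextw Dg) (lextw Dfg).
rewrite scaler_sumr -big_split; apply: eq_bigr => m _ /=.
by rewrite linearP scalerDl scalerA.
Qed.

HB.instance Definition _ :=
  GRing.isLinear.Build k (free_alg V) W _ (lext h) lext_is_linear.

Lemma lext_mono m : lext h (free_mono k m) = h m.
Proof.
rewrite (@lextw _ [fset m]%fset); last first.
  apply/fsubsetP => m'; rewrite -free_coef_supp free_coef_mono
    inE [m' == m]eq_sym.
  by case: (m == m'); rewrite ?eqxx.
by rewrite big_seq_fset1 free_coef_mono eqxx scale1r.
Qed.

End Lext.

Lemma freeE (f : free_alg V) :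
  f = \sum_(m <- msupp f) free_coef m f *: free_mono k m.
Proof.
apply: free_coefP => m; rewrite linear_sum /=.
under eq_bigr do rewrite linearZ /= free_coef_mono.
have [hm|hm] := boolP (m \in msupp f).
  rewrite (big_fsetD1 m) //= eqxx mulr1 big1_fset ?addr0 // => m'.
  by rewrite !inE => /andP[/negPf-> _]; rewrite mulr0.
rewrite big1_fset; first by apply/eqP; rewrite -[_ == _]negbK free_coef_supp.
by move=> m' hm' _; case: eqP hm hm' => [->/negP|]; rewrite ?mulr0.
Qed.

Lemma free_ind (P : free_alg V -> Prop) :
  P 0 -> (forall f g, P f -> P g -> P (f + g)) ->
  (forall c m, P (c *: free_mono k m)) -> forall f, P f.
Proof. by move=> P0 PD PZ f; rewrite (freeE f); elim/big_ind: _. Qed.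

Lemma eq_lext (W : lmodType k) (h1 h2 : monom V -> W) :
  h1 =1 h2 -> lext h1 =1 lext h2.
Proof. by move=> /funext->. Qed.

Lemma lextC (W : lmodType k) (h : monom V -> monom V -> W)
    (f g : free_alg V) :
  lext (fun a => lext (h a) g) f = lext (fun b => lext (h^~ b) f) g.
Proof.
rewrite lext.unlock.
transitivity (\sum_(a <- msupp f) \sum_(b <- msupp g)
    (free_coef a f * free_coef b g) *: h a b).
  apply: eq_bigr => a _; rewrite scaler_sumr.
  by apply: eq_bigr => b _; rewrite scalerA.
rewrite exchange_big; apply: eq_bigr => b _; rewrite scaler_sumr.
by apply: eq_bigr => a _; rewrite !scalerA mulrC.
Qed.

(* Bilinear extension of the product of monomials. *)
Definition free_mul (f g : free_alg V) : free_alg V :=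
  lext (fun a => lext (fun b => free_mono k (monom_mul a b)) g) f.

Fact free_mulC : commutative free_mul.
Proof.
move=> f g; rewrite /free_mul lextC; apply: eq_lext => b; apply: eq_lext => a.
by congr (free_mono k _); exact: monom_mulC.
Qed.

Fact free_mulDl x y z : free_mul (x + y) z = free_mul x z + free_mul y z.
Proof. exact: linearD. Qed.

Fact free_mulZl (c : k) x y : free_mul (c *: x) y = c *: free_mul x y.
Proof. exact: linearZ. Qed.

Fact free_mulDr x y z : free_mul x (y + z) = free_mul x y + free_mul x z.
Proof. by rewrite free_mulC free_mulDl !(free_mulC x). Qed.

Fact free_mulZr (c : k) x y : free_mul x (c *: y) = c *: free_mul x y.
Proof. by rewrite free_mulC free_mulZl free_mulC. Qed.

HB.instance Definition _ := Lmodule_isLinAlg.Build k (free_alg V)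
  free_mulDl free_mulDr free_mulZl free_mulZr.

HB.instance Definition _ := LinAlg_isCom.Build k (free_alg V) free_mulC.

Lemma mono_mul a b :
  free_mono k (monom_mul a b) = free_mono k a ** free_mono k b.
Proof. by rewrite /nmul /= /free_mul !lext_mono. Qed.

End Theory.

Section Universal.
Context (V : choiceType) (A : comLinAlgType k) (g : V -> A).

Fixpoint word_eval (w : word V) : A :=
  match w with
  | Leaf v => g v
  | Node a b => word_eval a ** word_eval b
  end.

Definition mono_eval (m : monom V) : A := word_eval (repr m).

Lemma weq_eval w1 w2 : weq w1 w2 -> word_eval w1 = word_eval w2.
Proof.
elim: w1 w2 => [v|a IHa b IHb] [w|c d] //=; first by move/eqP->.
by case/orP=> /andP[/IHa-> /IHb->] //; rewrite nmulC.
Qed.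

Lemma mono_eval_mul a b :
  mono_eval (monom_mul a b) = mono_eval a ** mono_eval b.
Proof. exact: weq_eval (weq_repr _). Qed.

Lemma lext_mul : {morph lext mono_eval : x y / x ** y}.
Proof.
move=> x y; elim/free_ind: x => [|f f' hf hf'|c m].
- by rewrite nmul0l !linear0 nmul0l.
- by rewrite nmulDl !linearD /= nmulDl hf hf'.
rewrite nmulZl !linearZ /= nmulZl; congr (_ *: _).
elim/free_ind: y => [|f f' hf hf'|d n].
- by rewrite nmul0r !linear0 nmul0r.
- by rewrite nmulDr !linearD /= nmulDr hf hf'.
by rewrite nmulZr !linearZ /= nmulZr -mono_mul !lext_mono mono_eval_mul.
Qed.

Definition free_ext : alg_hom (free_alg V) A := AlgHom lext_mul.

Theorem free_universal :
  (forall v, free_ext (free_gen v) = g v) /\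
  (forall nu : alg_hom (free_alg V) A,
      (forall v, nu (free_gen v) = g v) -> nu =1 free_ext).
Proof.
have gE v : free_ext (free_gen v) = g v.
  by rewrite /= lext_mono; apply: (@weq_eval _ (Leaf v)) (weq_repr _).
split=> // nu nuE; elim/free_ind => [|f h hf hh|c m].
- by rewrite !linear0.
- by rewrite !linearD hf hh.
rewrite !linearZ; congr (_ *: _).
elim/monom_ind: m => [v|a b ha hb]; first by rewrite nuE gE.
by rewrite mono_mul !homM ha hb.
Qed.

End Universal.

End FreeAlgebra.

(* $F^j$, spanned by the monomials of degree at least [j]; an ideal by
   [free_pow_ideal]. *)
Definition free_pow (k : fieldType) (V : choiceType) (j : nat) :
    set (free_alg k V) :=
  smallest (@is_subspace k (free_alg k V))
    [set free_mono k m | m in [set m : monom V | (j <= mdegree m)%N]].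

Arguments free_pow k V j : clear implicits.

Lemma free_pow_ideal (k : fieldType) (V : choiceType) (j : nat) :
  is_ideal (free_pow k V j).
Proof.
have FS : is_subspace (free_pow k V j).
  split; first by move=> U [[]].
  - by move=> x y hx hy U hU; case: (hU) => -[_ + _] _; apply;
    [apply: hx|apply: hy].
  - by move=> c x hx U hU; case: (hU) => -[_ _ +] _; apply; apply: hx.
have [F0 FD FZ] := FS.
have FM a x : free_pow k V j x -> free_pow k V j (a ** x).
  elim/free_ind: a x => [|f g hf hg|c m] x hx.
  - by rewrite nmul0l.
  - by rewrite nmulDl; apply: (FD); [apply: hf|apply: hg].
  rewrite nmulZl; apply: (FZ).
  apply: (hx [set y | free_pow k V j (free_mono k m ** y)]);
    split; first split=> /=.
  - by rewrite nmul0r.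
  - by move=> y z hy hz; rewrite nmulDr; apply: (FD).
  - by move=> d y hy; rewrite nmulZr; apply: (FZ).
  move=> _ [n hn <-] /=; rewrite -mono_mul; apply: sub_gen_smallest.
  exists (monom_mul m n) => //=; rewrite mdegree_mul.
  exact: leq_trans hn (leq_addl _ _).
split=> // a x hx; split; first exact: FM.
by rewrite nmulC; apply: FM.
Qed.

Section Geometry.
Context (k : fieldType).

(* [X0] is [nat], the index [i] standing for $x_{i+1}$. *)
Definition geom_closure (X : {fset nat}) (H : comLinAlgType k)
    (S : set (free_alg k X)) : set (free_alg k X) :=
  \bigcap_(mu in [set mu : alg_hom (free_alg k X) H | S `<=` alg_ker mu])
    alg_ker mu.

Definition geom_equiv (H1 H2 : comLinAlgType k) : Prop :=
  forall (X : {fset nat}) (S : set (free_alg k X)),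
    geom_closure H1 S = geom_closure H2 S.

End Geometry.

(* Main.v *)
(* A homomorphism mu from F to H^*_W that kills t satisfies
   phi(lam) y1(y1y2) + y2(y1^2) = 0 in H for y_i = mu(x_i).  Only the linear
   parts of the y_i contribute in degree 3, where T is spanned by t; comparing
   coefficients, and using phi(lam) <> lam and phi(lam) <> -1 (as
   phi(-1) = -1), forces y1 or y2 into H^2.  Hence mu also kills x1(x1x2), so
   x1(x1x2) lies in the closure of {t} with respect to H^*_W.  The closure of
   {t} with respect to H is contained in T, to which x1(x1x2) does not
   belong. *)
Require Import Defs.
From HB Require Import structures.
From mathcomp Require Import all_boot all_order all_algebra finmap.
From mathcomp Require Import boolp classical_sets ring.

Set Implicit Arguments.
Unset Strict Implicit.
Unset Printing Implicit Defensive.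

Import GRing.Theory.

Local Open Scope classical_set_scope.
Local Open Scope ring_scope.

(** * Degree filtration of the free algebra *)

Section FreePow.
Context (k : fieldType) (V : choiceType).
Local Notation F := (free_alg k V).
Local Notation Fp := (free_pow k V).
Implicit Types (i j : nat) (f g : F) (m : monom V).

Lemma free_pow0 j : Fp j 0.
Proof. by have [[]] := free_pow_ideal k V j. Qed.

Lemma free_powD j f g : Fp j f -> Fp j g -> Fp j (f + g).
Proof. by have [[_ + _] _] := free_pow_ideal k V j; apply. Qed.

Lemma free_powZ j c f : Fp j f -> Fp j (c *: f).
Proof. by have [[_ _ +] _] := free_pow_ideal k V j; apply. Qed.

Lemma free_powN j f : Fp j f -> Fp j (- f).
Proof. by move=> hf; rewrite -scaleN1r; apply: free_powZ. Qed.

Lemma free_pow_mono j m : (j <= mdegree m)%N -> Fp j (free_mono k m).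
Proof. by move=> hm; apply: sub_gen_smallest; exists m. Qed.

Lemma mdegree_gt0 m : (0 < mdegree m)%N.
Proof.
by elim/monom_ind: m => [v|a b ha hb];
  rewrite ?mdegree_var // mdegree_mul addn_gt0 ha.
Qed.

(** There is no empty monomial, so every factor counts for at least one degree in the estimates
    below. *)
Lemma free_pow1 f : Fp 1 f.
Proof.
elim/free_ind: f => [|f g|c m]; [exact: free_pow0|exact: free_powD|].
by apply: free_powZ; apply: free_pow_mono; apply: mdegree_gt0.
Qed.

Lemma free_powM i j f g : Fp i f -> Fp j g -> Fp (i + j) (f ** g).
Proof.
(* Membership in a span yields membership in any subspace containing the spanning monomials; this
   reduces first [f], then [g], to a monomial. *)
move=> hf; apply: (hf [set f | Fp j g -> Fp (i + j) (f ** g)]); split.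
  split=> /= [_|x y hx hy hg|c x hx hg].
  - by rewrite nmul0l; apply: free_pow0.
  - by rewrite nmulDl; apply: free_powD; [apply: hx|apply: hy].
  - by rewrite nmulZl; apply: free_powZ; apply: hx.
move=> _ [m hm <-] /= hg.
apply: (hg [set g | Fp (i + j) (free_mono k m ** g)]); split.
  split=> /= [|x y hx hy|c x hx].
  - by rewrite nmul0r; apply: free_pow0.
  - by rewrite nmulDr; apply: free_powD.
  - by rewrite nmulZr; apply: free_powZ; apply: hx.
move=> _ [n hn <-] /=; rewrite -mono_mul; apply: free_pow_mono.
by rewrite mdegree_mul leq_add.
Qed.

Lemma free_coef_pow j m f : (mdegree m < j)%N -> Fp j f -> free_coef m f = 0.
Proof.
move=> hm hf; apply: (hf [set f | free_coef m f = 0]); split.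
  split=> /= [|x y hx hy|c x hx]; first exact: linear0.
  - by rewrite linearD /= hx hy addr0.
  - by rewrite linearZ /= hx mulr0.
move=> _ [n /= hn <-]; rewrite free_coef_mono.
by case: eqP hn hm => // ->; rewrite leqNgt => /negP.
Qed.

(** Changing one factor at a time leaves three terms, each with one factor in [F^2] and two in
    [F^1]. Hence modulo [F^4] a triple product depends only on linear parts. *)
Lemma free_pow_sub3 f g h f' g' h' :
  Fp 2 (f - f') -> Fp 2 (g - g') -> Fp 2 (h - h') ->
  Fp 4 (f ** (g ** h) - f' ** (g' ** h')).
Proof.
move=> hf hg hh; have P1 := @free_pow1.
have -> : f ** (g ** h) - f' ** (g' ** h') =
    (f - f') ** (g ** h) + f' ** ((g - g') ** h) + f' ** (g' ** (h - h')).
  have nmulBl (x y z : F) : (x - y) ** z = x ** z - y ** z.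
    by rewrite nmulDl -scaleN1r nmulZl scaleN1r.
  have nmulBr (x y z : F) : z ** (x - y) = z ** x - z ** y.
    by rewrite nmulDr -scaleN1r nmulZr scaleN1r.
  by rewrite !(nmulBl, nmulBr) !addrA !subrK.
do 2?apply: free_powD.
- exact: (free_powM hf (free_powM (P1 g) (P1 h))).
- exact: (free_powM (P1 f') (free_powM hg (P1 h))).
- exact: (free_powM (P1 f') (free_powM (P1 g') hh)).
Qed.

End FreePow.

(** * Cubic relations in two generators *)

Section TwoGenerators.
Context (k : fieldType) (V : choiceType) (u v : V).
Hypotheses (neq_uv : u != v) (V_uv : forall w : V, w = u \/ w = v).
Local Notation F := (free_alg k V).
Local Notation Fp := (free_pow k V).
Local Notation lin a b := (a *: free_gen k u + b *: free_gen k v).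
Implicit Types (f g : F) (a b c d l s lam : k).

Lemma free_linear_part f : exists a b, Fp 2 (f - lin a b).
Proof.
elim/free_ind: f => [|f g [a [b hf]] [c [d hg]]|c m].
- by exists 0, 0; rewrite !scale0r addr0 subr0; apply: free_pow0.
- exists (a + c), (b + d); have := free_powD hf hg.
  by rewrite !scalerDl addrACA -opprD addrACA.
elim/monom_ind: m => [w|m n _ _].
  case: (V_uv w) => ->; [exists c, 0|exists 0, c];
    by rewrite scale0r ?addr0 ?add0r subrr; apply: free_pow0.
exists 0, 0; rewrite !scale0r addr0 subr0.
apply: free_powZ; apply: free_pow_mono.
by rewrite mdegree_mul (leq_add (mdegree_gt0 m) (mdegree_gt0 n)).
Qed.

Definition mono3 (p q r : V) : monom V :=
  monom_mul (mvar p) (monom_mul (mvar q) (mvar r)).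

Lemma mdegree_mono3 p q r : mdegree (mono3 p q r) = 3.
Proof. by rewrite !mdegree_mul !mdegree_var. Qed.

(** A leaf never matches a product, so commutativity can only swap the two inner letters. *)
Lemma mono3_eq p q r p' q' r' : (mono3 p q r == mono3 p' q' r') =
  (p == p') && ((q == q') && (r == r') || (q == r') && (r == q')).
Proof.
by rewrite /mono3 /mvar !monom_mul_pi (sameP eqP (monom_piP _ _)) /= orbF.
Qed.

Lemma gen_mul3 p q r :
  free_gen k p ** (free_gen k q ** free_gen k r) = free_mono k (mono3 p q r).
Proof. by rewrite /mono3 !mono_mul. Qed.

(** The shape of [t] with a free coefficient: [l] is [lam] for [t] itself and [phi lam] for its
    image in the twisted algebra. *)
Definition rel3 l f g : F := l *: (f ** (f ** g)) + g ** (f ** f).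

Lemma rel3_lin l a b c d : rel3 l (lin a b) (lin c d) =
  ((l + 1) * a ^+ 2 * c) *: free_mono k (mono3 u u u)
  + (l * a * (a * d + b * c) + 2 * a * b * c) *: free_mono k (mono3 u u v)
  + (l * a * b * d + b ^+ 2 * c) *: free_mono k (mono3 u v v)
  + (l * a * b * c + a ^+ 2 * d) *: free_mono k (mono3 v u u)
  + (l * b * (a * d + b * c) + 2 * a * b * d) *: free_mono k (mono3 v u v)
  + ((l + 1) * b ^+ 2 * d) *: free_mono k (mono3 v v v).
Proof.
(* Ordering the inner pair leaves the six commutative cubic monomials. *)
have E p : mono3 p v u = mono3 p u v.
  by rewrite /mono3 [monom_mul (mvar v) _]monom_mulC.
rewrite /rel3 !(nmulDl, nmulDr, nmulZl, nmulZr, gen_mul3, E).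
apply: free_coefP => m.
by rewrite !(linearD, linearZ) /=; ring.
Qed.

(** On the right, the only terms of degree 3 are [u(uv)] and [v(uu)], with coefficients [s * lam]
    and [s]; the other cubic coefficients on the left must vanish. *)
Lemma rel3_lin_degenerate l lam s a b c d g : l + 1 != 0 -> l != lam ->
  Fp 4 g ->
  rel3 l (lin a b) (lin c d) =
    s *: rel3 lam (free_gen k u) (free_gen k v) + g ->
  (a = 0 /\ b = 0) \/ (c = 0 /\ d = 0).
Proof.
move=> l1 l_lam hg; rewrite rel3_lin /rel3 !gen_mul3 => E.
have {}E m : mdegree m = 3 -> _ = _ := fun hm => congr1 (free_coef m) E.
have Eg p q r : free_coef (mono3 p q r) g = 0.
  by apply: free_coef_pow hg; rewrite mdegree_mono3.
have Euuu := E (mono3 u u u) (mdegree_mono3 _ _ _).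
have Euuv := E (mono3 u u v) (mdegree_mono3 _ _ _).
have Euvv := E (mono3 u v v) (mdegree_mono3 _ _ _).
have Evuu := E (mono3 v u u) (mdegree_mono3 _ _ _).
have Evvv := E (mono3 v v v) (mdegree_mono3 _ _ _).
move: Euuu Euuv Euvv Evuu Evvv.
rewrite !(linearD, linearZ) /= !free_coef_mono !mono3_eq !Eg.
have neq_vu : (v == u) = false by rewrite eq_sym (negbTE neq_uv).
rewrite !eqxx !neq_vu !(negbTE neq_uv) /=.
rewrite !(mulr0, mulr1, addr0, add0r).
move=> Euuu Euuv Euvv Evuu Evvv.
(* For [b] nonzero, the coefficient of [v(vv)] forces [d = 0], and then that of [u(vv)] forces
   [c = 0]. *)
have [b0|b0] := eqVneq b 0; last first.
  have d0 : d = 0.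
    move/eqP: Evvv; rewrite mulf_eq0 (negbTE (mulf_neq0 l1 _)) ?expf_neq0 //=.
    by move/eqP.
  move/eqP: Euvv; rewrite d0 mulr0 add0r mulf_eq0 expf_eq0 (negbTE b0) /=.
  by move/eqP; right.
have [a0|a0] := eqVneq a 0; first by left.
have c0 : c = 0.
  move/eqP: Euuu; rewrite mulf_eq0 (negbTE (mulf_neq0 l1 _)) ?expf_neq0 //=.
  by move/eqP.
(* With [b = c = 0] there remain [l * a ^+ 2 * d = s * lam] and [a ^+ 2 * d = s]; a nonzero [d]
   cancels to [l = lam]. *)
right; split=> //; apply: contra_neq_eq l_lam => d0.
apply: (@mulIf _ (a ^+ 2 * d)); first by rewrite mulf_neq0 ?expf_neq0.
move: Euuv; rewrite -Evuu b0 c0 => E1.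
by transitivity (l * a * (a * d + 0 * 0) + 2 * a * 0 * 0);
  [ring|rewrite E1; ring].
Qed.

(** The span of [t] and [F^4] is already an ideal: [t] lies in [F^3], so multiplying it by anything
    lands in [F^4]. *)
Lemma ideal_gen_rel3 lam f :
  ideal_set
    (ideal_gen ([set rel3 lam (free_gen k u) (free_gen k v)] `|` Fp 4)) f ->
  exists s g, Fp 4 g /\ f = s *: rel3 lam (free_gen k u) (free_gen k v) + g.
Proof.
set t := rel3 _ _ _ => Tf.
apply: (Tf [set f | exists s g, Fp 4 g /\ f = s *: t + g]); split; last first.
  move=> x [->|hx].
    by exists 1, 0; rewrite scale1r addr0; split=> //; apply: free_pow0.
  by exists 0, x; rewrite scale0r add0r.
have t3 : Fp 3 t.
  by rewrite /t /rel3 !gen_mul3; apply: free_powD; [apply: free_powZ|];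
    apply: free_pow_mono; rewrite mdegree_mono3.
split; first split.
- by exists 0, 0; rewrite scale0r addr0; split=> //; apply: free_pow0.
- move=> _ _ [s [g [hg ->]]] [s' [g' [hg' ->]]].
  exists (s + s'), (g + g'); rewrite scalerDl addrACA.
  by split=> //; apply: free_powD.
- move=> c _ [s [g [hg ->]]]; exists (c * s), (c *: g).
  by rewrite scalerDr scalerA; split=> //; apply: free_powZ.
move=> a _ [s [g [hg ->]]]; rewrite [_ ** a]nmulC.
have hag : Fp 4 (a ** (s *: t + g)).
  rewrite nmulDr; apply: free_powD; 
    first exact: (free_powM (free_pow1 a) (free_powZ s t3)).
  by have [_ /(_ a g hg) []] := free_pow_ideal k V 4.
by split; exists 0, (a ** (s *: t + g)); rewrite scale0r add0r.
Qed.

(** The coefficient of [v(uu)] forces [s = 0], whereas that of [u(uv)] requires [s * lam = 1]. *)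
Lemma gen_mul3_notin_ideal lam :
  ~ ideal_set
      (ideal_gen ([set rel3 lam (free_gen k u) (free_gen k v)] `|` Fp 4))
      (free_gen k u ** (free_gen k u ** free_gen k v)).
Proof.
move=> /ideal_gen_rel3[s [g [hg]]]; rewrite /rel3 !gen_mul3 => E.
have Eg p q r : free_coef (mono3 p q r) g = 0.
  by apply: free_coef_pow hg; rewrite mdegree_mono3.
have := congr1 (free_coef (mono3 u u v)) E.
have := congr1 (free_coef (mono3 v u u)) E.
rewrite !(linearD, linearZ) /= !free_coef_mono !mono3_eq !Eg.
rewrite !eqxx [v == u]eq_sym (negbTE neq_uv) /=.
rewrite !(mulr0, mulr1, addr0, add0r) => <- /eqP.
by rewrite mul0r oner_eq0.
Qed.

Lemma ideal_gen_rel3_subst l lam f g : l + 1 != 0 -> l != lam ->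
  ideal_set
    (ideal_gen ([set rel3 lam (free_gen k u) (free_gen k v)] `|` Fp 4))
    (rel3 l f g) ->
  Fp 4 (f ** (f ** g)).
Proof.
move=> l1 l_lam /ideal_gen_rel3[s [h [hh E]]].
have [a [b hf]] := free_linear_part f; have [c [d hg]] := free_linear_part g.
(* Passing to linear parts costs an error in [F^4], which is absorbed into the remainder [h]. *)
have D : Fp 4 (rel3 l (lin a b) (lin c d) - rel3 l f g).
  rewrite -opprB; apply: free_powN; rewrite /rel3 opprD addrACA -scalerBr.
  by apply: free_powD; [apply: free_powZ|]; apply: free_pow_sub3.
have /(rel3_lin_degenerate l1 l_lam (free_powD D hh)) :
    rel3 l (lin a b) (lin c d) =
    s *: rel3 lam (free_gen k u) (free_gen k v)
    + (rel3 l (lin a b) (lin c d) - rel3 l f g + h).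
  by rewrite addrCA -E subrK.
(* A vanishing linear part puts [f] or [g] in [F^2], so [f(fg)] gains the missing degree. *)
case=> -[e1 e2].
  move: hf; rewrite e1 e2 !scale0r addr0 subr0 => hf.
  exact: (free_powM hf (free_powM (free_pow1 f) (free_pow1 g))).
move: hg; rewrite e1 e2 !scale0r addr0 subr0 => hg.
exact: (free_powM (free_pow1 f) (free_powM (free_pow1 f) hg)).
Qed.

End TwoGenerators.

(** * The two closures of [t] *)

Theorem proposition5p3 (k : fieldType) (char_k : [pchar k] =i pred0)
    (phi : {rmorphism k -> k}) (phi_bij : bijective phi)
    (phi_neq_id : ~ (phi =1 id)) (lam : k) (phi_lam : phi lam <> lam) :
  let X : {fset nat} := [fset 0%N; 1%N]%fset in
  let F : comLinAlgType k := free_alg k X in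
  let x1 : F := free_gen k [` fset21 0%N 1%N]%fset in
  let x2 : F := free_gen k [` fset22 0%N 1%N]%fset in
  let t : F := lam *: (x1 ** (x1 ** x2)) + x2 ** (x1 ** x1) in
  let T : ideal F := ideal_gen ([set t] `|` free_pow k X 4) in
  let H : comLinAlgType k := quot_alg T in
  ~ geom_equiv H (twist phi H).

Proof.
move=> X F x1 x2 t T H equiv.
pose u : X := [` fset21 0%N 1%N]%fset.
pose v : X := [` fset22 0%N 1%N]%fset.
have neq_uv : u != v by [].
have V_uv (w : X) : w = u \/ w = v.
  by case/fset2P: (valP w) => e; [left|right]; apply: val_inj.
have l1 : phi lam + 1 != 0.
  apply: contra_not_neq phi_lam => e; apply: (bij_inj phi_bij).
  have -> : lam = - 1.
    apply/eqP; rewrite -addr_eq0; apply/eqP/(bij_inj phi_bij).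
    by rewrite rmorphD rmorph1 rmorph0.
  by rewrite !rmorphN1.
have pi0 : quot_pi T 0 = 0 by rewrite -(scale0r 0) quot_piZ scale0r.
pose f0 : F := x1 ** (x1 ** x2).
have twist_kills : geom_closure (twist phi H) [set t] f0.
  move=> mu /= /(_ t erefl); rewrite /alg_ker /=.
  rewrite linearD linearZ /= !homM.
  (* Lifting the images to representatives in [F] turns [mu t = 0] into an ideal membership; the
     twisted action supplies the coefficient [phi lam]. *)
  rewrite -[mu x1](@quot_reprK _ _ T) -[mu x2](@quot_reprK _ _ T).
  set f1 := quot_repr (mu x1); set f2 := quot_repr (mu x2) => mu_t.
  have Tf : ideal_set T (rel3 (phi lam) f1 f2).
    rewrite -[rel3 _ _ _]subr0; apply/quot_pi_eq.
    rewrite /rel3 quot_piD quot_piZ !quot_piM pi0; exact: mu_t.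
  have f4 := ideal_gen_rel3_subst neq_uv V_uv l1 (introN eqP phi_lam) Tf.
  suff: quot_pi T (f1 ** (f1 ** f2)) = 0 by rewrite !quot_piM.
  rewrite -pi0; apply/quot_pi_eq; rewrite subr0.
  by apply: sub_gen_smallest; right.
(* The projection onto [H] kills [t] and has kernel [T], so it bounds the closure over [H] by
   [T]. *)
have piD : linear (quot_pi T : F -> H).
  by move=> c x y; rewrite quot_piD quot_piZ.
pose pi_lin : {linear F -> H} := HB.pack (quot_pi T : F -> H)
  (GRing.isLinear.Build k F H _ _ piD).
pose pi : alg_hom F H := @AlgHom k F H pi_lin (@quot_piM k F T).
move: twist_kills; rewrite -equiv => /(_ pi) /=.
have pi_t : [set t] `<=` alg_ker pi.
  move=> _ ->; rewrite /alg_ker /= -pi0; apply/quot_pi_eq.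
  by rewrite subr0; apply: sub_gen_smallest; left.
move=> /(_ pi_t); rewrite /alg_ker /= -pi0 => /quot_pi_eq; rewrite subr0.
exact: gen_mul3_notin_ideal.
Qed.
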